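(* Assume that all $S_i$, $i=1,2,\dots,n$, are invertible and that $A_i=0$ for $i=2,3,\ldots,n$ in $\mathcal{A}_n$. If the Schur complement based preconditioner is $\mathcal{D}_n$, then the eigenvalues of $\mathcal{T}_n=\mathcal{D}_n^{-1}\mathcal{A}_n$ are the roots of the polynomials $\bar p_1,\bar p_2,\ldots,\bar p_n$ defined by $$\bar p_i=\lambda\,\bar p_{i-1}+\bar p_{i-2},\qquad i=2,3,4,\ldots,n,$$ with $\bar p_0(\lambda)=1$, $\bar p_1(\lambda)=\lambda-1$. Moreover, all the roots of $\bar p_i$, $i=1,2,\ldots,n$, lie in the right half-plane $\{z\in\mathbb{C}:\operatorname{Re} z>0\}$. If $\mathcal{T}_n=\mathcal{D}_n^{-1}\mathcal{A}_n$ is further assumed to be diagonalizable, then $\mathcal{T}_n$ satisfies the polynomial equation $\prod_{i=0}^{n}\bar p_i=0$, i.e. $\prod_{i=0}^{n}\bar p_i(\mathcal{T}_n)=0$.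
   Context: Let $n\ge 2$ and $m_1,\dots,m_n\ge 1$. For $i=1,\dots,n$, $A_i$ is an $m_i\times m_i$ matrix, and for $i=1,\dots,n-1$, $B_i$ and $C_i$ are $m_{i+1}\times m_i$ matrices. No symmetry is assumed. The block tridiagonal matrix $\mathcal{A}_n$ has $(i,i)$ block $(-1)^{i-1}A_i$, $(i,i+1)$ block $B_i^T$, $(i+1,i)$ block $C_i$, and all other blocks zero: $$\mathcal{A}_n=\begin{bmatrix} A_1 & B_1^T & & \\ C_1 & -A_2 & \ddots & \\ & \ddots & \ddots & B_{n-1}^T\\ & & C_{n-1} & (-1)^{n-1}A_n\end{bmatrix}.$$ The nested Schur complements are $S_1=A_1$ and $S_{i+1}=A_{i+1}+C_iS_i^{-1}B_i^T$ for $i=1,\dots,n-1$. $\mathcal{D}_n$ is the block diagonal matrix with $(i,i)$ block $(-1)^{i-1}S_i$, $i=1,\dots,n$. Eigenvalues and roots are taken in $\mathbb{C}$.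
   Formalization: Equality of the eigenvalues with all the roots fails (n=2, all blocks 1×1, A_1=B_1=C_1=1, A_2=0: root 1 of p̄_1 is no eigenvalue); proved: each eigenvalue is a root of some p̄_i, and the roots of p̄_i are eigenvalues if i=n or m_{i+1}<m_i. *)

(* Defs.v *)
From HB Require Import structures.
From mathcomp Require Import all_boot all_order all_algebra.
From mathcomp Require Import reals complex.

Set Implicit Arguments.
Unset Strict Implicit.
Unset Printing Implicit Defensive.

Import GRing.Theory.
Local Open Scope ring_scope.

(* Indices start at 0: the mathematical m_i, A_i, B_i, C_i, S_i are m i.-1,
   A i.-1, B i.-1, C i.-1, S i.-1. The families are indexed by all of nat to
   keep the dependent types simple; the matrices below with n x n blocks only
   involve m i and A i for i < n, and B i and C i for i.+1 < n. *)

Fixpoint schur (F : comUnitRingType) (m : nat -> nat)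
    (A : forall i, 'M[F]_(m i)) (B C : forall i, 'M[F]_(m i.+1, m i))
    (i : nat) : 'M[F]_(m i) :=
  match i with
  | 0 => A 0%N
  | j.+1 => A j.+1 + C j *m invmx (schur A B C j) *m (B j)^T
  end.

(* The guards make the dimensions agree, so conform_mx is always a mere
   change of type here: it never returns its default value 0. *)
Definition tridiag_block (F : comUnitRingType) (m : nat -> nat)
    (A : forall i, 'M[F]_(m i)) (B C : forall i, 'M[F]_(m i.+1, m i))
    (i j : nat) : 'M[F]_(m i, m j) :=
  if i == j then conform_mx 0 ((-1) ^+ i *: A i)
  else if j == i.+1 then conform_mx 0 (B i)^T
  else if i == j.+1 then conform_mx 0 (C j)
  else 0.

Definition tridiag_mx (F : comUnitRingType) (n : nat) (m : nat -> nat)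
    (A : forall i, 'M[F]_(m i)) (B C : forall i, 'M[F]_(m i.+1, m i)) :
    'M[F]_(\sum_(i < n) m i) :=
  \mxblock_(i < n, j < n) tridiag_block A B C i j.

Definition schur_mx (F : comUnitRingType) (n : nat) (m : nat -> nat)
    (A : forall i, 'M[F]_(m i)) (B C : forall i, 'M[F]_(m i.+1, m i)) :
    'M[F]_(\sum_(i < n) m i) :=
  \mxdiag_(i < n) ((-1) ^+ i *: schur A B C i).

Definition precond_mx (F : comUnitRingType) (n : nat) (m : nat -> nat)
    (A : forall i, 'M[F]_(m i)) (B C : forall i, 'M[F]_(m i.+1, m i)) :
    'M[F]_(\sum_(i < n) m i) :=
  invmx (schur_mx n A B C) *m tridiag_mx n A B C.

Fixpoint pbar (F : comUnitRingType) (i : nat) : {poly F} :=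
  match i with
  | 0 => 1
  | 1 => 'X - 1
  | (j.+1 as k).+1 => 'X * pbar F k + pbar F j
  end.

(* horner_mx is only available when the dimension is syntactically a
   successor, which \sum_(i < n) m i is not. *)
Definition mxpoly_eval (F : comNzRingType) (d : nat) (p : {poly F})
    (T : 'M[F]_d) : 'M[F]_d :=
  \sum_(k < size p) p`_k *: T ^+ k.

Lemma mxpoly_evalE (F : comNzRingType) (d : nat) (p : {poly F})
  (T : 'M[F]_d.+1) : mxpoly_eval p T = horner_mx T p.
Proof.
rewrite -[in RHS](coefK p) poly_def rmorph_sum /=; apply: eq_bigr => k _.
by rewrite linearZ /= rmorphXn /= horner_mx_X.
Qed.

Lemma tridiag_block_diag (F : comUnitRingType) (m : nat -> nat)
    (A : forall i, 'M[F]_(m i)) (B C : forall i, 'M[F]_(m i.+1, m i)) i :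
  tridiag_block A B C i i = (-1) ^+ i *: A i.
Proof. by rewrite /tridiag_block eqxx conform_mx_id. Qed.

Lemma tridiag_block_up (F : comUnitRingType) (m : nat -> nat)
    (A : forall i, 'M[F]_(m i)) (B C : forall i, 'M[F]_(m i.+1, m i)) i :
  tridiag_block A B C i i.+1 = (B i)^T.
Proof. by rewrite /tridiag_block ltn_eqF // eqxx conform_mx_id. Qed.

Lemma tridiag_block_down (F : comUnitRingType) (m : nat -> nat)
    (A : forall i, 'M[F]_(m i)) (B C : forall i, 'M[F]_(m i.+1, m i)) i :
  tridiag_block A B C i.+1 i = C i.
Proof. by rewrite /tridiag_block gtn_eqF // ltn_eqF // eqxx conform_mx_id. Qed.

(* Main.v *)
(** With [A_i = 0] for [i > 1], the relation [S_(i+1) = C_i S_i^-1 B_i^T] turns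
    the left eigenvalue problem for [D^-1 A] into a scalar three-term
    recurrence along the blocks, solved by [p_0(l), p_1(l), ...]. The end of
    the recurrence is a root [p_i(l) = 0], either at the last block or at a
    block where some [B_i^T] has a nontrivial left kernel. For the location of
    the roots, multiply [l p_j = p_(j+1) - p_(j-1)] by the conjugate of [p_j]
    and sum over [j < i]: the off-diagonal terms are purely imaginary, so
    [Re l * \sum_(j < i) |p_j|^2 = 1] when [p_i(l) = 0]. *)

Require Import Defs.
From HB Require Import structures.
From mathcomp Require Import all_boot all_order all_algebra.
From mathcomp Require Import reals complex ring zify.

Set Implicit Arguments.
Unset Strict Implicit.
Unset Printing Implicit Defensive.

Import Order.TTheory GRing.Theory Num.Theory.
Local Open Scope ring_scope.
Local Open Scope complex_scope.

(** * The scalar recurrence and the location of its roots *)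

Lemma pbarSS (F : comUnitRingType) k :
  pbar F k.+2 = 'X * pbar F k.+1 + pbar F k.
Proof. by []. Qed.

Lemma horner_pbar1 (F : comUnitRingType) (l : F) : (pbar F 1).[l] = l - 1.
Proof. by rewrite /= !hornerE. Qed.

Lemma horner_pbarSS (F : comUnitRingType) k (l : F) :
  (pbar F k.+2).[l] = l * (pbar F k.+1).[l] + (pbar F k).[l].
Proof. by rewrite pbarSS !hornerE. Qed.

(* [p_0, ..., p_k] is, up to a boundary term, an eigenvector at [l] of a real
   tridiagonal matrix whose only symmetric part is the entry 1 in its corner. *)
Lemma pbar_sum_sqr (K : numClosedFieldType) (l : K) k :
  (l + l^*)%R * (\sum_(j < k.+1) (pbar K j).[l] * ((pbar K j).[l])^*%R) =
  2 + (pbar K k.+1).[l] * ((pbar K k).[l])^*%R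
    + ((pbar K k.+1).[l])^*%R * (pbar K k).[l].
Proof.
elim: k => [|k IHk].
  by rewrite big_ord1 horner_pbar1 /= hornerC rmorphB !rmorph1; ring.
rewrite big_ord_recr /= mulrDr IHk horner_pbarSS rmorphD rmorphM; ring.
Qed.

Lemma pbar_root_Re_gt0 (K : numClosedFieldType) (l : K) k :
  root (pbar K k) l -> 0 < 'Re l.
Proof.
case: k => [|k]; first by rewrite /root /= hornerC oner_eq0.
move=> /rootP pk0; have := pbar_sum_sqr l k.
rewrite pk0 rmorph0 !mul0r !addr0 => sumE.
(* Strict positivity comes from the term [j = 0], which equals 1. *)
have sum_gt0 : 0 < \sum_(j < k.+1) (pbar K j).[l] * ((pbar K j).[l])^*%R.
  rewrite big_ord_recl /= hornerC rmorph1 mulr1 ltr_wpDr ?ltr01 //.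
  by apply: sumr_ge0 => j _; rewrite mul_conjC_ge0.
by rewrite ReE divr_gt0 // -(pmulr_lgt0 _ sum_gt0) sumE.
Qed.

(** The minimal polynomial of a diagonalizable matrix is a product of distinct linear factors, one
    per eigenvalue, so it divides [q]. *)
Lemma mxpoly_eval_diagonalizable (F : fieldType) d (T : 'M[F]_d)
    (q : {poly F}) :
  diagonalizable T -> (forall l, eigenvalue T l -> root q l) ->
  mxpoly_eval q T = 0.
Proof.
case: d T => [|d] T; first by move=> *; rewrite flatmx0.
move=> /diagonalizableP[rs uniq_rs /dvdp_prod_XsubC[b minE]] rootq.
rewrite mxpoly_evalE; apply/mxminpoly_minP.
rewrite (eqp_dvdl _ minE); apply: uniq_roots_dvdp; last first.
  by rewrite uniq_rootsE mask_uniq.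
apply/allP => l rs_l; apply: rootq.
by rewrite eigenvalue_root_min (eqp_root minE) root_prod_XsubC.
Qed.

(** * The eigenvalue problem in block form *)

Section Blocks.

Variables (F : fieldType) (n : nat) (m : nat -> nat).
Variables (A : forall i, 'M[F]_(m i)) (B C : forall i, 'M[F]_(m i.+1, m i)).

Local Notation S := (schur A B C).

(* Indexing the blocks by [nat], with zeros from [n] on, avoids casts between
   dimensions and makes the boundary conditions at the last block uniform. *)
Lemma mxrow_nat (v : 'rV[F]_(\sum_(i < n) m i)) :
  exists2 u : forall i, 'rV[F]_(m i),
    forall i, (n <= i)%N -> u i = 0 & v = \mxrow_(i < n) u i.
Proof.
exists (fun i => match @idP (i < n)%N with
                 | ReflectT lt_in => submxrow v (Ordinal lt_in)
                 | ReflectF _ => 0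
                 end).
  by move=> i; rewrite leqNgt => /negP le_ni; case: {-}_ / idP.
rewrite -[LHS]submxrowK; apply: eq_mxrow => i.
case: {-}_ / idP => [lt_in|]; last by rewrite ltn_ord.
by case: i lt_in => i lt_in lt_in'; rewrite (bool_irrelevance lt_in' lt_in).
Qed.

Definition mul_superdiag (u : forall i, 'rV[F]_(m i)) j : 'rV[F]_(m j) :=
  match j with 0 => 0 | k.+1 => u k *m (B k)^T end.

Lemma tridiag_block_eq0 i j :
  (i.+1 < j)%N || (j.+1 < i)%N -> tridiag_block A B C i j = 0.
Proof.
move=> far; rewrite /tridiag_block.
by do 3 (case: eqP => [?|_]; first by exfalso; lia).
Qed.

Lemma mul_tridiag_block (u : forall i, 'rV[F]_(m i)) (j : 'I_n) :
  (forall i, (n <= i)%N -> u i = 0) ->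
  \sum_(i < n) u i *m tridiag_block A B C i j =
  mul_superdiag u j + (-1) ^+ j *: (u j *m A j) + u j.+1 *m C j.
Proof.
move=> u0; pose f i := u i *m tridiag_block A B C i j.
have f0l i : (n <= i)%N -> f i = 0 by move=> /u0 ui0; rewrite /f ui0 mul0mx.
have f0r i : (j.+2 <= i)%N -> f i = 0.
  by move=> ltji; rewrite /f tridiag_block_eq0 ?ltji ?orbT // mulmx0.
have ftail a b : (a <= b)%N -> (forall i, (a <= i)%N -> f i = 0) ->
    \sum_(0 <= i < b) f i = \sum_(0 <= i < a) f i.
  move=> leab f0; rewrite (big_cat_nat (leq0n a) leab) /=.
  rewrite [X in _ + X]big_nat_cond.
  by rewrite [X in _ + X]big1 ?addr0 // => i /andP[/andP[/f0]].
rewrite -[LHS](big_mkord xpredT f).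
(* The sums up to [n] and up to [j.+2] are compared through a common longer one: [f] vanishes from
   [n] on because [u] does, and from [j.+2] on by tridiagonality. *)
rewrite -(ftail n (n + j.+2)%N) ?leq_addr // (ftail j.+2) ?leq_addl //.
rewrite !big_nat_recr //= /f tridiag_block_diag tridiag_block_down -scalemxAr.
congr (_ + _ + _); case: {f f0l f0r ftail} (nat_of_ord j) => [|k].
  by rewrite big_nil.
rewrite big_nat_recr //= tridiag_block_up big_nat_cond big1 ?add0r //.
move=> i /andP[/andP[_ ltik] _].
by rewrite tridiag_block_eq0 ?mulmx0 // ltnS ltik.
Qed.

Hypothesis S_unit : forall i, (i < n)%N -> S i \in unitmx.

Lemma schur_mx_unit : schur_mx n A B C \in unitmx.
Proof.
rewrite -row_free_unit; apply: inj_row_free => v.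
have [u _ ->] := mxrow_nat v.
rewrite mul_mxrow_mxdiag -[RHS]mxrow0 => /eq_mxrowP uS0.
rewrite -[RHS]mxrow0; apply: eq_mxrow => i; apply/eqP.
have /eqP := uS0 i; rewrite -scalemxAr scaler_eq0 signr_eq0 /= => /eqP uSi.
by rewrite -(mulmxK (S_unit (ltn_ord i)) (u i)) uSi mul0mx.
Qed.

(* The eigenvalue problem [v *m T = l *: v], written in the unknown
   [u = v *m D^-1], where [T = D^-1 *m A], and split into blocks. *)
Lemma eigenvalue_precondP l :
  reflect (exists u : forall i, 'rV[F]_(m i),
    [/\ forall i, (n <= i)%N -> u i = 0, exists i, u i != 0
      & forall j, (j < n)%N ->
          mul_superdiag u j + (-1) ^+ j *: (u j *m A j) + u j.+1 *m C j =
          (l * (-1) ^+ j) *: (u j *m S j)])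
    (eigenvalue (precond_mx n A B C) l).
Proof.
have pencilP (u : forall i, 'rV[F]_(m i)) : (forall i, (n <= i)%N -> u i = 0) ->
    \mxrow_(i < n) u i *m tridiag_mx n A B C =
      l *: (\mxrow_(i < n) u i *m schur_mx n A B C) <->
    forall j, (j < n)%N ->
      mul_superdiag u j + (-1) ^+ j *: (u j *m A j) + u j.+1 *m C j =
      (l * (-1) ^+ j) *: (u j *m S j).
  move=> u0; rewrite mul_mxrow_mxblock mul_mxrow_mxdiag -mul_mx_scalar.
  rewrite -(mxdiagZ l) mul_mxrow_mxdiag -eq_mxrowP.
  split=> [eqA j ltjn|eqA j].
    have := eqA (Ordinal ltjn); rewrite mul_tridiag_block //= => ->.
    by rewrite mul_mx_scalar -scalemxAr scalerA.
  by rewrite mul_tridiag_block // eqA // mul_mx_scalar -scalemxAr scalerA.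
apply: (iffP eigenvalueP) => [[v vT v0]|[u [u0 [i ui0] eqA]]].
  have [u u0 uE] := mxrow_nat (v *m invmx (schur_mx n A B C)).
  have vE : v = \mxrow_(i < n) u i *m schur_mx n A B C.
    by rewrite -uE mulmxKV ?schur_mx_unit.
  exists u; split=> //; last first.
    by apply/pencilP => //; rewrite -vE -vT -uE mulmxA.
  have [/existsP[i ui0]|/existsPn u_eq0] := boolP [exists i : 'I_n, u i != 0].
    by exists i.
  case/eqP: v0; rewrite vE; suff -> : \mxrow_(i < n) u i = 0 by rewrite mul0mx.
  by rewrite -[RHS]mxrow0; apply: eq_mxrow => i; apply/eqP/negPn/u_eq0.
exists (\mxrow_(i < n) u i *m schur_mx n A B C).
  by rewrite mulmxA mulmxK ?schur_mx_unit //; apply/pencilP.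
have ltin : (i < n)%N by rewrite ltnNge; apply: contra ui0 => /u0 ->.
apply: contra ui0 => /eqP uS0.
have : \mxrow_(i < n) u i = \mxrow_(i < n) (0 : 'rV[F]_(m i)).
  by rewrite mxrow0 -(mulmxK schur_mx_unit (\mxrow_(i < n) u i)) uS0 mul0mx.
by move=> /eq_mxrowP /(_ (Ordinal ltin)) /= ->.
Qed.

(** * Eigenvalues when only the first diagonal block may be nonzero *)

Hypothesis A_eq0 : forall i, (0 < i < n)%N -> A i = 0.

Lemma schurS_eq0 j : (j.+1 < n)%N -> S j.+1 = C j *m invmx (S j) *m (B j)^T.
Proof. by move=> ltjn; rewrite /= A_eq0 ?add0r. Qed.

Local Notation p := (pbar F).

(* Eliminating the blocks from the top turns the block equations into
   [p_j u_(j+1) C_j = +- p_(j+1) u_j S_j]; as [u_n = 0], the vector [u]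
   vanishes from the bottom up when no [p_j] does. *)
Lemma eigenvalue_precond_pbar l :
  eigenvalue (precond_mx n A B C) l ->
  exists2 i, (1 <= i <= n)%N & root (p i) l.
Proof.
case/eigenvalue_precondP=> u [u0 [k uk0] eqA].
have elim j : (j < n)%N ->
    (p j).[l] *: (u j.+1 *m C j) =
    ((-1) ^+ j * (p j.+1).[l]) *: (u j *m S j).
  elim: j => [|j IHj] ltjn; have := eqA _ ltjn.
    rewrite /mul_superdiag /= !expr0 add0r !scale1r mulr1 mul1r => eq0.
    rewrite hornerC scale1r horner_pbar1 scalerBl scale1r -eq0.
    by rewrite addrAC subrr add0r.
  rewrite A_eq0 // mulmx0 scaler0 addr0 [mul_superdiag _ _]/= => eqj.
  have {eqj}-> : u j.+2 *m C j.+1 =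
      (l * (-1) ^+ j.+1) *: (u j.+1 *m S j.+1) - u j *m (B j)^T.
    by rewrite -eqj addrC addKr.
  move/(_ (ltnW ltjn)): IHj.
  (* Right multiplication by [S_j^-1 B_j^T] turns [C_j] into [S_(j+1)] and [S_j] into [B_j^T]. *)
  move/(congr1 (fun w => w *m (invmx (S j) *m (B j)^T))).
  rewrite -!scalemxAl -!mulmxA [C j *m _]mulmxA -schurS_eq0 // => IHj.
  rewrite (mulmxA (S j)) mulmxV ?S_unit 1?ltnW // mul1mx in IHj.
  rewrite horner_pbarSS scalerBr scalerA.
  have -> : (p j.+1).[l] *: (u j *m (B j)^T) =
      ((-1) ^+ j * (p j).[l]) *: (u j.+1 *m S j.+1).
    by rewrite -scalerA IHj scalerA mulrA -expr2 sqrr_sign mul1r.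
  rewrite -scalerBl; congr (_ *: _); rewrite exprS.
  by move: ((-1) ^+ j) => e; ring.
have [/existsP[i pi0]|/existsPn p_neq0] :=
  boolP [exists i : 'I_n, root (p i.+1) l].
  by exists i.+1; rewrite ?ltn_ord.
suff uz d i : (n <= i + d)%N -> u i = 0.
  by rewrite (uz n k) ?leq_addl ?eqxx in uk0.
elim: d i => [|d IHd] i; first by rewrite addn0 => /u0.
rewrite addnS -addSn => /IHd ui1; case: (leqP n i) => [/u0 //|ltin].
have /esym/eqP := elim i ltin; rewrite ui1 mul0mx scaler0 scaler_eq0.
rewrite mulf_eq0 signr_eq0 /= -/(root _ _).
rewrite (negPf (p_neq0 (Ordinal ltin))) /= => /eqP uSi.
by rewrite -(mulmxK (S_unit ltin) (u i)) uSi mul0mx.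
Qed.

(** Solve downwards from [w_k = x] by [w_j = w_(j+1) C_j S_j^-1]. *)
Lemma schur_chain k (x : 'rV[F]_(m k)) : (k < n)%N ->
  exists w : forall i, 'rV[F]_(m i),
    [/\ w k = x, forall j, (k < j)%N -> w j = 0
      & forall j, (j < k)%N -> w j *m S j = w j.+1 *m C j].
Proof.
elim: k x => [|k IHk] x ltkn.
  exists (fun i => if i == 0 then conform_mx 0 x else 0); split=> //=.
    by rewrite conform_mx_id.
  by case.
have [w [wk w0 wS]] := IHk (x *m C k *m invmx (S k)) (ltnW ltkn).
exists (fun i => if i == k.+1 then conform_mx 0 x else w i); split.
- by rewrite eqxx conform_mx_id.
- by move=> j ltkj; rewrite gtn_eqF // w0 // ltnW.
move=> j; rewrite ltnS leq_eqVlt => /orP[/eqP->|ltjk].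
  by rewrite eqxx ltn_eqF // conform_mx_id wk mulmxKV // S_unit // ltnW.
by rewrite !ltn_eqF ?wS // ltnW.
Qed.

(* The eigenvector is [u_j = t_j p_j(l) w_j], where [w] is the chain from
   [schur_chain] ending at [x]. The signs [t = 1, 1, -1, -1, ...] absorb the
   alternating signs of the block equations. *)
Lemma pbar_eigenvalue_precond l k (x : 'rV[F]_(m k)) : (k < n)%N ->
  root (p k.+1) l -> x != 0 -> ((k.+1 < n)%N -> x *m (B k)^T = 0) ->
  eigenvalue (precond_mx n A B C) l.
Proof.
move=> ltkn /rootP pk0 x0 xB0; have [w [wk w0 wS]] := schur_chain x ltkn.
(* With this, all terms of block equation [j <= k] become scalar multiples of [w_j S_j]. *)
have wB j : (j < k)%N -> w j *m (B j)^T = w j.+1 *m S j.+1.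
  move=> ltjk; have ltj1n : (j.+1 < n)%N by apply: leq_trans ltkn.
  by rewrite schurS_eq0 // 2!mulmxA -wS // mulmxK ?S_unit // ltnW.
pose t j : F := (-1) ^+ 'C(j, 2).
have tS j : t j.+1 = (-1) ^+ j * t j by rewrite /t binS bin1 exprD mulrC.
have tSS j : t j.+2 = - t j.
  rewrite !tS exprS -mulrA [_ ^+ j * (_ * _)]mulrA -expr2.
  by rewrite sqrr_sign mulN1r mul1r.
apply/eigenvalue_precondP; exists (fun j => (t j * (p j).[l]) *: w j); split.
- by move=> i leni; rewrite w0 ?scaler0 // (leq_trans ltkn).
- exists 0%N; rewrite /= hornerC mulr1 scaler_eq0 signr_eq0 /=.
  (* If [w_0] were zero, [wB] would carry zero up the chain to [w_k = x]. *)
  apply: contra x0 => /eqP w00; rewrite -wk.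
  suff wz j : (j <= k)%N -> w j = 0 by rewrite wz.
  elim: j => // j IHj ltjk; have ltj1n := leq_ltn_trans ltjk ltkn.
  rewrite -(mulmxK (S_unit ltj1n) (w j.+1)) -wB // IHj ?mul0mx //.
  exact: ltnW.
move=> j ltjn; have [lejk|ltkj] := leqP j k; last first.
  (* Beyond block [k] only the equation [j = k.+1] has a term left, [w_k B_k^T], and [x] is in the
     left kernel of [B_k^T]. *)
  rewrite (w0 j) // (w0 j.+1 (leqW ltkj)) ?(scaler0, mul0mx, addr0).
  case: j ltkj ltjn => // j; rewrite ltnS leq_eqVlt /=.
  case/orP=> [/eqP<-|ltkj _]; last by rewrite w0 // scaler0 mul0mx.
  by move=> ltk1n; rewrite wk -scalemxAl xB0 // scaler0.
(* At [j = k] the chain relation stops, but both sides vanish because [p_(k+1)(l) = 0]. *)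
have -> : (t j.+1 * (p j.+1).[l]) *: w j.+1 *m C j =
    (t j.+1 * (p j.+1).[l]) *: (w j *m S j).
  move: lejk; rewrite leq_eqVlt => /orP[/eqP->|ltjk].
    by rewrite pk0 mulr0 !scale0r mul0mx.
  by rewrite -scalemxAl wS.
case: j ltjn lejk => [|j] ltjn lejk.
  rewrite /= !hornerE -!scalemxAl !scalerA -!scalerDl.
  by congr (_ *: _); ring.
rewrite [mul_superdiag _ _]/= -!scalemxAl wB // A_eq0 // mulmx0 !scaler0 addr0.
rewrite scalerA -scalerDl; congr (_ *: _).
rewrite horner_pbarSS tSS tS exprS.
have := sqrr_sign F j; move: ((-1) ^+ j) => e e2; ring: e2.
Qed.

End Blocks.

Theorem theorem3p2 (R : realType) (n : nat) (m : nat -> nat)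
    (A : forall i : nat, 'M[R[i]]_(m i))
    (B C : forall i : nat, 'M[R[i]]_(m i.+1, m i))
    (n_ge2 : (2 <= n)%N)
    (m_ge1 : forall i : nat, (i < n)%N -> (1 <= m i)%N)
    (S_unit : forall i : nat, (i < n)%N -> schur A B C i \in unitmx)
    (A_eq0 : forall i : nat, (0 < i < n)%N -> A i = 0) :
  let T := precond_mx n A B C in
  let p := pbar R[i] in
  [/\ (forall l : R[i], eigenvalue T l ->
         exists2 i : nat, (1 <= i <= n)%N & root (p i) l),
      (forall (i : nat) (l : R[i]), (1 <= i <= n)%N ->
         i = n \/ (m i < m i.-1)%N -> root (p i) l -> eigenvalue T l),
      (forall (i : nat) (l : R[i]), (1 <= i <= n)%N ->
         root (p i) l -> 0 < complex.Re l) &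
      (diagonalizable T -> mxpoly_eval (\prod_(0 <= i < n.+1) p i) T = 0)].
Proof.
move=> T p; have eigT l := eigenvalue_precond_pbar S_unit A_eq0 (l := l).
split=> //.
- case=> // k l /= ltkn choice rootk.
  have [x x0 xB] : exists2 x : 'rV[R[i]]_(m k), x != 0
      & (k.+1 < n)%N -> x *m (B k)^T = 0.
    case: choice => [kn|ltm].
      exists (const_mx 1); last by move=> ltkSn; rewrite kn ltnn in ltkSn.
      apply/eqP => /rowP /(_ (Ordinal (m_ge1 k ltkn))); rewrite !mxE => /eqP.
      by rewrite oner_eq0.
    (* [B_k^T] has fewer columns than rows, hence a nontrivial left kernel. *)
    exists (nz_row (kermx (B k)^T)).
      rewrite nz_row_eq0 kermx_eq0 -row_leq_rank -ltnNge.
      exact: leq_ltn_trans (rank_leq_col _) ltm.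
    by move=> _; apply/sub_kermxP/nz_row_sub.
  exact: pbar_eigenvalue_precond rootk x0 xB.
- move=> i l _ /pbar_root_Re_gt0; rewrite -complexRe.
  by rewrite ltcE => /andP[].
move=> diagT; apply: mxpoly_eval_diagonalizable => // l.
case/eigT=> i /andP[_ lein] /rootP pil.
rewrite big_mkord rootE horner_prod.
by rewrite (bigD1 (Ordinal (lein : (i < n.+1)%N))) //= pil mul0r.
Qed.
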